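(* For every positive integer $n$, let $B_n$ be the hyperoctahedral group and $I_n^B=\{w\in B_n : w^{-1}=w\}$ its set of involutions, and set \[ I_n^B(x)=\sum_{w\in I_n^B} x^{\mathrm{des}_B(w)}, \] with the convention $I_0^B(x)=1$. Then, as formal power series in $x$ and $t$, \[ \sum_{n\geq 0} \frac{I_n^B(x)}{(1-x)^{n+1}}\, t^n \;=\; \sum_{m\geq 0} \frac{x^m}{(1-t)^{2m+1}(1-t^2)^{m^2}}. \]
   Context: $B_n$ is the group of signed permutations, i.e. bijections $w$ of $\{\pm1,\dots,\pm n\}$ with $w(-a)=-w(a)$. Use the total order $-1<_r-2<_r\cdots<_r 0<_r 1<_r 2<_r\cdots$ on $\mathbb{Z}$. For $w\in B_n$ set $w(0):=0$ and define $\mathrm{des}_B(w)=|\{i\in\{0,1,\dots,n-1\} : w(i)>_r w(i+1)\}|$. *)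

(* Defs.v *)
From HB Require Import structures.
From mathcomp Require Import all_boot all_order all_fingroup all_algebra.
(* For function extensionality and the eqType and choiceType of power series. *)
From mathcomp Require Import boolp.

Set Implicit Arguments.
Unset Strict Implicit.
Unset Printing Implicit Defensive.

Import Order.TTheory GRing.Theory Num.Theory.
Local Open Scope ring_scope.

(* A formal power series over R, given by its sequence of coefficients. This is
   a record, not an alias of nat -> R, so as to avoid the pointwise ring
   structure of functions. *)
Record fps (R : Type) := Fps { coefs : nat -> R }.

Declare Scope fps_scope.
Delimit Scope fps_scope with fps.
Local Open Scope fps_scope.
Notation "{ 'fps' R }" := (fps R) (format "{ 'fps'  R }") : type_scope.
Notation "f ^[ n ]" := (coefs f n)
  (at level 1, n at level 200, format "f ^[ n ]") : fps_scope.

Lemma fpsP (R : Type) (f g : {fps R}) : (forall n, f^[n] = g^[n]) <-> f = g.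
Proof.
split=> [|-> //]; case: f g => f [g] /= fg.
by congr Fps; apply: funext.
Qed.

HB.instance Definition _ (R : Type) := gen_eqMixin {fps R}.
HB.instance Definition _ (R : Type) := gen_choiceMixin {fps R}.

Definition fps_zero (R : zmodType) : {fps R} := Fps (fun=> 0).
Definition fps_opp (R : zmodType) (f : {fps R}) := Fps (fun n => - f^[n]).
Definition fps_add (R : zmodType) (f g : {fps R}) := Fps (fun n => f^[n] + g^[n]).

Lemma fps_addA (R : zmodType) : associative (@fps_add R).
Proof. by move=> f g h; apply/fpsP => n /=; rewrite addrA. Qed.
Lemma fps_addC (R : zmodType) : commutative (@fps_add R).
Proof. by move=> f g; apply/fpsP => n /=; rewrite addrC. Qed.
Lemma fps_add0 (R : zmodType) : left_id (@fps_zero R) (@fps_add R).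
Proof. by move=> f; apply/fpsP => n /=; rewrite add0r. Qed.
Lemma fps_addN (R : zmodType) :
  left_inverse (@fps_zero R) (@fps_opp R) (@fps_add R).
Proof. by move=> f; apply/fpsP => n /=; rewrite addNr. Qed.

HB.instance Definition _ (R : zmodType) :=
  GRing.isZmodule.Build {fps R}
    (@fps_addA R) (@fps_addC R) (@fps_add0 R) (@fps_addN R).

Definition fps_const (R : zmodType) (c : R) : {fps R} :=
  Fps (fun n => if n == 0%N then c else 0).
Definition fps_mul (R : pzRingType) (f g : {fps R}) : {fps R} :=
  Fps (fun n => \sum_(i < n.+1) f^[i] * g^[n - i]).

Definition fps_trunc (R : nzRingType) (n : nat) (f : {fps R}) : {poly R} :=
  \poly_(i < n) f^[i].

Lemma fps_mul_trunc (R : nzRingType) (N n : nat) (f g : {fps R}) : (n < N)%N ->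
  (fps_mul f g)^[n] = (fps_trunc N f * fps_trunc N g)`_n.
Proof.
move=> ltnN; rewrite coefM /=; apply: eq_bigr => i _; rewrite !coef_poly.
by rewrite (leq_ltn_trans (leq_ord i) ltnN) (leq_ltn_trans (leq_subr i n) ltnN).
Qed.

Lemma fps_mulA (R : comNzRingType) : associative (@fps_mul R).
Proof.
move=> f g h; apply/fpsP => n.
pose T := fps_trunc n.+1 : {fps R} -> {poly R}.
transitivity ((T f * (T g * T h))`_n).
  rewrite coefM /=; apply: eq_bigr => i _.
  rewrite coef_poly ltn_ord -[RHS](congr1 _ (fps_mul_trunc _ _ _)) //.
  by rewrite ltnS leq_subr.
rewrite mulrA coefM /=; apply: eq_bigr => i _.
by rewrite coef_poly ltnS leq_subr -fps_mul_trunc.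
Qed.

Lemma fps_mulC (R : comNzRingType) : commutative (@fps_mul R).
Proof.
by move=> f g; apply/fpsP => n; rewrite !(@fps_mul_trunc _ n.+1) // mulrC.
Qed.

Lemma fps_mul1 (R : comNzRingType) : left_id (fps_const (1 : R)) (@fps_mul R).
Proof.
move=> f; apply/fpsP => n /=.
rewrite big_ord_recl /= mul1r subn0 big1 ?addr0 // => i _.
by rewrite mul0r.
Qed.

Lemma fps_mulD (R : comNzRingType) : left_distributive (@fps_mul R) +%R.
Proof.
move=> f g h; apply/fpsP => n /=; rewrite -big_split /=.
by apply: eq_bigr => i _; rewrite mulrDl.
Qed.

Lemma fps_one_neq0 (R : comNzRingType) : fps_const (1 : R) != 0.
Proof. by apply/eqP => /fpsP /(_ 0%N) /= /eqP; rewrite oner_eq0. Qed.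

HB.instance Definition _ (R : comNzRingType) :=
  GRing.Zmodule_isComNzRing.Build {fps R} (@fps_mulA R) (@fps_mulC R)
    (@fps_mul1 R) (@fps_mulD R) (@fps_one_neq0 R).

(* The first n coefficients of 1 / f, from the recursion
   \sum_(i < n.+1) g_i * f_(n - i) = (n == 0). *)
Fixpoint fps_inv_seq (R : unitRingType) (f : {fps R}) (n : nat) : seq R :=
  if n is m.+1 then
    let s := fps_inv_seq f m in
    rcons s (((m == 0%N)%:R - \sum_(i < m) s`_i * f^[m - i]) / f^[0])
  else [::].

Definition fps_unit (R : unitRingType) : {pred {fps R}} :=
  fun f => f^[0] \is a GRing.unit.
Definition fps_inv (R : unitRingType) (f : {fps R}) : {fps R} :=
  if fps_unit f then Fps (fun n => (fps_inv_seq f n.+1)`_n) else f.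

Lemma size_fps_inv_seq (R : unitRingType) (f : {fps R}) n :
  size (fps_inv_seq f n) = n.
Proof. by elim: n => //= n IHn; rewrite size_rcons IHn. Qed.

Lemma nth_fps_inv_seq (R : unitRingType) (f : {fps R}) n i : (i < n)%N ->
  (fps_inv_seq f n)`_i = (fps_inv_seq f i.+1)`_i.
Proof.
elim: n => // n IHn; rewrite ltnS leq_eqVlt => /predU1P[-> //|lt_in].
by rewrite [LHS]/= nth_rcons size_fps_inv_seq lt_in IHn.
Qed.

Lemma fps_mulV (R : comUnitRingType) :
  {in @fps_unit R, left_inverse 1 (@fps_inv R) *%R}.
Proof.
move=> f; rewrite /in_mem /= => Uf; apply/fpsP => n.
rewrite /fps_inv Uf [LHS]big_ord_recr subnn.
rewrite [X in X * f^[0]]/= nth_rcons size_fps_inv_seq ltnn eqxx divrK //.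
rewrite (eq_bigr (fun i : 'I_n => (fps_inv_seq f n)`_i * f^[n - i])) => [|i _].
  by rewrite [LHS]addrC subrK /=; case: eqP.
by rewrite (nth_fps_inv_seq f (ltn_ord i)).
Qed.

Lemma fps_unitPl (R : comUnitRingType) (f g : {fps R}) :
  g * f = 1 -> fps_unit f.
Proof.
move/fpsP/(_ 0%N); rewrite [LHS]big_ord1 subn0 => gf1.
by apply/unitrPr; exists g^[0]; rewrite mulrC.
Qed.

Lemma fps_inv_out (R : comUnitRingType) :
  {in [predC @fps_unit R], @fps_inv R =1 id}.
Proof. by move=> f; rewrite inE /= /fps_inv /in_mem /= => /negbTE ->. Qed.

HB.instance Definition _ (R : comUnitRingType) :=
  GRing.ComNzRing_hasMulInverse.Build {fps R}
    (@fps_mulV R) (@fps_unitPl R) (@fps_inv_out R).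

Definition fps_var (R : nzRingType) : {fps R} := Fps (fun n => (n == 1%N)%:R).

(* Z[[x, t]] is represented as Z[[x]][[t]]: the coefficient of x^i t^j in f is
   f^[j]^[i]. *)
Notation fps2 := {fps {fps int}}.
Definition fps_x : fps2 := fps_const (fps_var int).
Definition fps_t : fps2 := fps_var {fps int}.

(* The infinite sum of the F k exists and equals S: each coefficient of the
   partial sums is eventually constant, equal to that of S. *)
Definition fps2_has_sum (F : nat -> fps2) (S : fps2) : Prop :=
  forall i j : nat, exists N : nat, forall M : nat, (N <= M)%N ->
    (\sum_(k < M) F k)^[j]^[i] = S^[j]^[i].

(* The set {-n, ..., -1, 1, ..., n}: (s, i) stands for (-1)^s * (i + 1). *)
Definition pm (n : nat) : finType := (bool * 'I_n)%type.
Definition pm_opp (n : nat) (a : pm n) : pm n := (~~ a.1, a.2).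
Definition pm_int (n : nat) (a : pm n) : int := (-1) ^+ a.1 * (a.2.+1)%:Z.

Definition hyperoct (n : nat) : {set {perm pm n}} :=
  [set w : {perm pm n} | [forall a, w (pm_opp a) == pm_opp (w a)]].

Definition hyperoct_invol (n : nat) : {set {perm pm n}} :=
  [set w in hyperoct n | w^-1%g == w].

(* -1 < -2 < -3 < ... < 0 < 1 < 2 < ... *)
Definition lt_r (a b : int) : bool :=
  if a < 0 then (if b < 0 then b < a else true)
  else (if b < 0 then false else a < b).

(* w(k) for 0 <= k <= n, with w(0) = 0 (and the junk value 0 for k > n). *)
Definition sperm_val (n : nat) (w : {perm pm n}) (k : nat) : int :=
  if k is k'.+1 then
    if insub k' is Some i then pm_int (w (false, i)) else 0
  else 0.

Definition desB (n : nat) (w : {perm pm n}) : nat :=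
  #|[set i : 'I_n | lt_r (sperm_val w i.+1) (sperm_val w i)]|.

(* The value at x of the polynomial I_n^B. *)
Definition involB_des (R : pzRingType) (n : nat) (x : R) : R :=
  \sum_(w in hyperoct_invol n) x ^+ desB w.

Lemma involB_des0 (R : pzRingType) (x : R) : involB_des 0 x = 1.
Proof.
have pm0 (a : pm 0) : False by case: a => _ [].
rewrite /involB_des (big_pred1 (1%g : {perm pm 0})) => [|w].
  by rewrite /desB eq_card0 // => -[].
have -> : w = 1%g by apply/permP => a; case: (pm0 a).
rewrite !inE invg1 eqxx andbT.
by apply/forallP => a; case: (pm0 a).
Qed.

(* Main.v *)
(** Both sides have the same coefficient of [x^m t^n], namely the number of pairs
    [(w, f)] where [w] is an involution of [B_n] and
    [0 = f 0 <= f 1 <= ... <= f n <= m] increases strictly at the descents of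
    [w].  For fixed [w] these [f] are counted by [x^des(w) / (1 - x)^(n+1)].
    On the other side, send [(w, f)] to the multiset of points
    [(f k, sgn (w k) * f |w k|)], [1 <= k <= n]; it is invariant under the
    involution [(c, d) -> (d, c)], [(c, -d) -> (d, -c)].  Compatibility of [f]
    with the descents of [w] means that the points are listed in lexicographic
    order and that [|w|] is increasing on each set of equal points, so that
    [(w, f)] is recovered from the multiset by standardization.  There are
    [2m+1] fixed points and [m^2] orbits of size two, whence the product
    [1 / ((1 - t)^(2m+1) (1 - t^2)^(m^2))]. *)

From HB Require Import structures.
Require Import Defs.
From mathcomp Require Import all_boot all_order all_fingroup all_algebra.
From mathcomp Require Import zify.

Set Implicit Arguments.
Unset Strict Implicit.
Unset Printing Implicit Defensive.

Import Order.TTheory GRing.Theory Num.Theory.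
Local Open Scope ring_scope.
Local Open Scope fps_scope.

(** * Coefficients of power series *)

Section FpsCoefficients.
Variable R : comUnitRingType.
Implicit Types f g : {fps R}.

Lemma coef_fpsD f g n : (f + g)^[n] = f^[n] + g^[n]. Proof. by []. Qed.
Lemma coef_fpsN f n : (- f)^[n] = - f^[n]. Proof. by []. Qed.

Lemma coef_fpsM f g n : (f * g)^[n] = \sum_(i < n.+1) f^[i] * g^[n - i].
Proof. by []. Qed.

Lemma coef_fps_sum (I : Type) (r : seq I) (P : pred I) (F : I -> {fps R}) n :
  (\sum_(i <- r | P i) F i)^[n] = \sum_(i <- r | P i) (F i)^[n].
Proof. exact: (big_morph (fun f => f^[n]) (fun f g => coef_fpsD f g n) erefl). Qed.

Lemma coef_fps_natr k n : (k%:R : {fps R})^[n] = if n == 0%N then k%:R else 0.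
Proof.
elim: k => [|k IHk]; first by rewrite if_same.
by rewrite mulrS coef_fpsD IHk /=; case: (n == 0)%N; rewrite ?addr0 // mulrS.
Qed.

Lemma fps_const_is_zmod_morphism : zmod_morphism (@fps_const R).
Proof. by move=> a b; apply/fpsP => -[|n] //=; rewrite subr0. Qed.

Lemma coef_fps_constM (c : R) f n : (fps_const c * f)^[n] = c * f^[n].
Proof.
rewrite coef_fpsM big_ord_recl /= subn0 big1 ?addr0 // => i _.
by rewrite mul0r.
Qed.

Lemma fps_const_is_monoid_morphism : monoid_morphism (@fps_const R).
Proof.
split=> // a b; apply/fpsP => n; rewrite coef_fps_constM /=.
by case: n => [|n] /=; rewrite ?mulr0.
Qed.

HB.instance Definition _ := GRing.isZmodMorphism.Build R {fps R} (@fps_const R)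
  fps_const_is_zmod_morphism.
HB.instance Definition _ := GRing.isMonoidMorphism.Build R {fps R} (@fps_const R)
  fps_const_is_monoid_morphism.

Lemma coef_fps_varM f n :
  (fps_var R * f)^[n] = if n is n'.+1 then f^[n'] else 0.
Proof.
rewrite coef_fpsM; case: n => [|n]; first by rewrite big_ord1 mul0r.
rewrite big_ord_recl mul0r add0r big_ord_recl mul1r subSS subn0.
by rewrite big1 ?addr0 // => i _; rewrite mul0r.
Qed.

Lemma coef_fps_varXM k f n :
  (fps_var R ^+ k * f)^[n] = if (k <= n)%N then f^[n - k] else 0.
Proof.
elim: k n => [|k IHk] n; first by rewrite mul1r subn0.
by rewrite exprS -mulrA coef_fps_varM; case: n => // n; rewrite IHk.
Qed.

Lemma coef_fps_varX k n : (fps_var R ^+ k)^[n] = (n == k)%:R.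
Proof.
rewrite -[_ ^+ k]mulr1 coef_fps_varXM /= subn_eq0.
by case: ltngtP.
Qed.

Definition fps_geom w : {fps R} := Fps (fun n => (w %| n)%N%:R).

Lemma mul_fps_geom w : (0 < w)%N -> (1 - fps_var R ^+ w) * fps_geom w = 1.
Proof.
move=> w0; apply/fpsP => n.
rewrite mulrBl mul1r coef_fpsD coef_fpsN coef_fps_varXM /=.
case: n => [|n] /=; first by rewrite leqNgt w0 dvdn0 subr0.
case: leqP => [le|lt]; first by rewrite dvdn_subl ?subrr //.
by rewrite gtnNdvd ?subr0.
Qed.

Definition fps_binom k : {fps R} := Fps (fun n => 'C(n + k, k)%:R).

(** Multiplication by [1 - fps_var R] takes differences of consecutive coefficients, so Pascal's
    rule lowers [k] by one. *)
Lemma mul_fps_binom k : (1 - fps_var R) ^+ k.+1 * fps_binom k = 1.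
Proof.
elim: k => [|k IHk].
  rewrite -[RHS](@mul_fps_geom 1) // !expr1; congr (_ * _).
  by apply/fpsP => n /=; rewrite bin0 dvd1n.
rewrite exprSr -mulrA -[RHS]IHk; congr (_ * _); apply/fpsP => n.
rewrite mulrBl mul1r coef_fpsD coef_fpsN coef_fps_varM /=.
case: n => [|n]; first by rewrite !add0n !binn subr0.
by rewrite addnS binS addSnnS natrD addrAC subrr add0r addnS.
Qed.

(* Both sides are compared modulo t^(n+1), where the factors become finite
   geometric sums that can be expanded. *)
Lemma coef_prod_fps_geom (I : finType) (D : pred I) (wt : I -> nat) n :
    (forall i, D i -> 0 < wt i)%N ->
  (\prod_(i | D i) fps_geom (wt i))^[n] =
  #|[set a : {ffun I -> 'I_n.+1} | (a \in pffun_on ord0 D predT)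
      && (\sum_(i | D i) wt i * a i == n)%N]|%:R.
Proof.
move=> wt0; pose T w : {fps R} := \sum_(k < n.+1) fps_var R ^+ (w * k).
have geomT w k : (0 < w)%N -> (k <= n)%N -> (fps_geom w)^[k] = (T w)^[k].
  move=> w0 le_kn; rewrite /T coef_fps_sum /=.
  under eq_bigr => j _ do rewrite coef_fps_varX.
  have [/dvdnP[q kE]|ndv] := boolP (w %| k)%N.
    have ltq : (q < n.+1)%N by rewrite ltnS (leq_trans _ le_kn) // kE leq_pmulr.
    rewrite (bigD1 (Ordinal ltq)) //= kE mulnC eqxx big1 ?addr0 // => j nej.
    rewrite eqn_pmul2l //; case: eqP => // qE.
    by case/eqP: nej; apply: val_inj.
  rewrite big1 // => j _; case: eqP => // kE.
  by rewrite kE dvdn_mulr in ndv.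
transitivity ((\prod_(i | D i) T (wt i))^[n]).
  have: forall k, (k <= n)%N ->
      (\prod_(i | D i) fps_geom (wt i))^[k] = (\prod_(i | D i) T (wt i))^[k].
    elim/big_rec2: _ => [//|i f g Di IH] k le_kn.
    rewrite !coef_fpsM; apply: eq_bigr => j _.
    rewrite geomT ?wt0 ?IH // ?(leq_trans (leq_subr _ _)) //.
    exact: leq_trans (leq_ord j) le_kn.
  by apply.
rewrite /T (big_distr_big ord0) coef_fps_sum.
under eq_bigr => a _ do rewrite -expr_sum coef_fps_varX eq_sym.
rewrite -sum1_card natr_sum (eq_bigl _ _ (fun a => in_set _ a)) big_mkcondr /=.
by apply: eq_bigr => a _; case: eqP.
Qed.

End FpsCoefficients.

(** * Words and standardization *)

Section Combinatorics.
Local Open Scope nat_scope.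

Section Standardization.
Variables (n : nat) (C : finType) (u : 'I_n -> C).

Definition level (p : C) : {set 'I_n} := [set j | u j == p].

(** The letter of an index and its rank among equal letters determine the index; standardization
    preserves this rank. *)
Definition level_rank (k : 'I_n) := #|[set j in level (u k) | j < k]|.

Lemma ltn_level_rank k l : u k = u l -> k < l -> level_rank k < level_rank l.
Proof.
move=> ukl lt_kl; apply: proper_card; apply/properP; split.
  by apply/subsetP => j; rewrite !inE ukl => /andP[-> /ltn_trans->].
by exists k; rewrite !inE ?ltnn ?andbF // ukl eqxx.
Qed.

Lemma level_rank_inj k l : u k = u l -> level_rank k = level_rank l -> k = l.
Proof.
move=> ukl eq_r; apply: val_inj.
by case: (ltngtP k l) => // /ltn_level_rank; rewrite ukl eq_r ltnn => /(_ erefl).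
Qed.

Lemma level_rank_max k : level_rank k < #|level (u k)|.
Proof.
apply: proper_card; apply/properP; split.
  by apply/subsetP => j; rewrite inE => /andP[].
by exists k; rewrite !inE ?ltnn ?andbF.
Qed.

(** Pigeonhole: the ranks on a level are distinct numbers below its size. *)
Lemma level_rank_onto p r :
  r < #|level p| -> exists2 k, u k = p & level_rank k = r.
Proof.
move=> lt_r.
pose rk (k : 'I_n) : 'I_n.+1 := inord (level_rank k).
have rkE k : rk k = level_rank k :> nat.
  by rewrite inordK // ltnS -[leqRHS]card_ord max_card.
have le_n : #|level p| <= n by rewrite -[leqRHS]card_ord max_card.
have: inord r \in rk @: level p.
  have -> : rk @: level p = [set i : 'I_n.+1 | i < #|level p|].
    apply/eqP; rewrite eqEcard; apply/andP; split.
      apply/subsetP => _ /imsetP[k /[!inE] /eqP <- ->].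
      by rewrite rkE level_rank_max.
    rewrite card_in_imset; last first.
      move=> k l /[!inE] /eqP uk /eqP ul /(congr1 (@nat_of_ord _)).
      by rewrite !rkE => /level_rank_inj ->; rewrite ?uk ?ul.
    rewrite cardsE -sum1_card -(big_ord_widen_cond n.+1 xpredT (fun=> 1)) ?leqW //.
    by rewrite sum1_card card_ord.
  by rewrite inE inordK // (leq_trans lt_r) // leqW.
case/imsetP => k /[!inE] /eqP uk /(congr1 (@nat_of_ord _)).
rewrite rkE inordK; last by rewrite (leq_trans lt_r) // leqW.
by move=> ->; exists k.
Qed.

Variable s : C -> C.

(** For the word of points of a pair [(w, f)], [s] is the reflection of points and [t] is [|w|]. *)
Definition standardizes (t : 'I_n -> 'I_n) :=
  [/\ involutive t, forall k, u (t k) = s (u k)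
    & forall k l, u k = u l -> k < l -> t k < t l].

(** [t] sends the earlier indices of the level of [k] injectively to earlier indices of the level of
    [t k], so ranks cannot drop; as [t] is an involution, they are equal. *)
Lemma level_rank_standardizes t k :
  standardizes t -> level_rank (t k) = level_rank k.
Proof.
case=> tK ut t_incr.
suff le l : level_rank l <= level_rank (t l).
  by apply/eqP; rewrite eqn_leq le -{2}[k]tK le.
rewrite {1}/level_rank -(card_imset _ (inv_inj tK)); apply: subset_leq_card.
apply/subsetP => _ /imsetP[j /[!inE] /andP[/eqP uj lt_jl] ->].
by rewrite !ut uj eqxx t_incr.
Qed.

Lemma card_level_standardizes t p :
  standardizes t -> involutive s -> #|level (s p)| = #|level p|.
Proof.
case=> tK ut _ sK; rewrite -(card_imset (level p) (inv_inj tK)).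
apply: eq_card => k; rewrite -{2}[k]tK (mem_imset _ _ (inv_inj tK)) !inE ut.
by rewrite -[X in s _ == X](sK p) (inj_eq (inv_inj sK)).
Qed.

(** The letter at [t k] is [s (u k)] and its rank is that of [k], which leaves one choice. *)
Lemma standardizes_uniq t t' : standardizes t -> standardizes t' -> t =1 t'.
Proof.
move=> st st' k; apply: level_rank_inj.
  by case: st st' => _ -> _ [_ -> _].
by rewrite !level_rank_standardizes.
Qed.

(** [t k] is the index with letter [s (u k)] and the rank of [k]; it exists because the two levels
    have equal size. *)
Lemma standardizes_exists :
    involutive s -> (forall p, #|level (s p)| = #|level p|) ->
  exists t, standardizes t.
Proof.
move=> sK cards.
have [k|t tP] := @fin_all_exists _ (fun=> 'I_n)
    (fun k l => u l = s (u k) /\ level_rank l = level_rank k).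
  have [|l ul rl] := @level_rank_onto (s (u k)) (level_rank k).
    by rewrite cards level_rank_max.
  by exists l.
exists t; split=> [k|k|k l ukl lt_kl].
- by apply: level_rank_inj; case: (tP k) (tP (t k)) => ? ? [? ?]; congruence.
- by case: (tP k).
have [utk rtk] := tP k; have [utl rtl] := tP l.
have uE : u (t k) = u (t l) by congruence.
have lt_r := ltn_level_rank ukl lt_kl.
rewrite ltnNge; apply/negP; rewrite leq_eqVlt => /predU1P[/val_inj tE|gt].
  by move: lt_r; rewrite -rtk -rtl tE ltnn.
by move: (ltn_level_rank (esym uE) gt); rewrite rtk rtl ltnNge ltnW.
Qed.

End Standardization.

(** * Sorted words with given multiplicities *)

Section SortedWords.
Variables (n : nat) (C : finType) (code : C -> nat).

Definition word_sorted (u : 'I_n -> C) :=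
  forall k l : 'I_n, k <= l -> code (u k) <= code (u l).

Let le_code : rel C := relpre code leq.

Lemma count_word (u : 'I_n -> C) p :
  count_mem p [seq u k | k <- enum 'I_n] = #|level u p|.
Proof.
rewrite count_map -sum1_count big_enum_cond /= -sum1_card.
by apply: eq_bigl => k; rewrite inE.
Qed.

Lemma word_sorted_inj (u v : 'I_n -> C) :
    injective code -> word_sorted u -> word_sorted v ->
  (forall p, #|level u p| = #|level v p|) -> u =1 v.
Proof.
have sW (w : 'I_n -> C) : word_sorted w -> sorted le_code [seq w k | k <- enum 'I_n].
  move=> w_sorted; rewrite sorted_map.
  apply: (@sub_sorted _ (relpre val leq)) => [k l|]; first exact: w_sorted.
  by rewrite -sorted_map val_enum_ord iota_sorted.
move=> code_inj /sW su /sW sv eq_uv.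
have /eq_in_map uv : [seq u k | k <- enum 'I_n] = [seq v k | k <- enum 'I_n].
  apply: (@sorted_eq _ le_code) => //.
  - by move=> p q r; apply: leq_trans.
  - by move=> p q /anti_leq/code_inj.
  by apply/allP => p _ /=; rewrite !count_word eq_uv.
by move=> k; apply: uv; rewrite mem_enum.
Qed.

Lemma word_sorted_exists (M : C -> nat) : \sum_p M p = n ->
  exists2 u : 'I_n -> C, word_sorted u & forall p, #|level u p| = M p.
Proof.
move=> sumM.
pose s0 := flatten [seq nseq (M p) p | p <- enum C].
pose s := sort le_code s0.
have szs : size s == n.
  rewrite size_sort size_flatten /shape -map_comp sumnE big_map big_enum /=.
  by rewrite -sumM; apply/eqP/eq_bigr => p _; rewrite /= size_nseq.
pose t := Tuple szs; exists (tnth t) => [k l le_kl|p].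
  have x0 := tnth t k; rewrite !(tnth_nth x0) /=.
  apply: (@sorted_leq_nth _ le_code) => //.
  - by move=> p q r; apply: leq_trans.
  - by move=> p; apply: leqnn.
  - by apply: sort_sorted => p q; apply: leq_total.
  - by rewrite inE (eqP szs).
  - by rewrite inE (eqP szs).
rewrite -count_word map_tnth_enum /= (seq.permP (permEl (perm_sort _ _))).
rewrite count_flatten -map_comp sumnE big_map big_enum /=.
rewrite (bigD1 p) //= count_nseq /= eqxx mul1n big1 ?addn0 // => q neq.
by rewrite count_nseq /= (negbTE neq).
Qed.

End SortedWords.

(** * Signed involutions and compatible functions *)

Lemma sorted_tupleP n m (t : n.-tuple 'I_m) :
  reflect (forall k l : 'I_n, l = k.+1 :> nat -> tnth t k <= tnth t l)
          (sorted leq (map val t)).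
Proof.
have tE (k : 'I_n) : nth 0 (map val t) k = tnth t k.
  by rewrite -(tnth_nth 0 (map_tuple _ t)) tnth_map.
apply: (iffP (sortedP 0)) => [st k l eq_l|st i].
  by rewrite -!tE eq_l st // size_map size_tuple -eq_l.
rewrite size_map size_tuple => lt_in; have lt_in' := ltnW lt_in.
by rewrite (tE (Ordinal lt_in)) (tE (Ordinal lt_in')) st.
Qed.

(** * Counting compatible functions *)

Section CompatibleFunctions.
Variables (n m : nat).
Implicit Types (D : pred nat) (f : {ffun 'I_n -> 'I_m.+1}).

(* [f] is indexed from 0, the extension from 1, with value 0 at 0. *)
Definition ext_val f (k : nat) : nat :=
  if k is k'.+1 then if insub k' is Some i then f i : nat else 0 else 0.

(** [D i] counts as 0 or 1: weak increase everywhere, strict increase at the positions in [D]. *)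
Definition compatible D f :=
  [forall i : 'I_n, ext_val f i + D i <= ext_val f i.+1].

Lemma ext_valS f (k : 'I_n) : ext_val f k.+1 = f k.
Proof. by rewrite /= valK. Qed.

Lemma ext_val_max f k : ext_val f k <= m.
Proof. by case: k => //= k; case: insub => // i; rewrite -ltnS ltn_ord. Qed.

(** The total increase that [D] forces between positions 0 and [k]. *)
Let E D k := \sum_(i < k) D i.

Lemma compatible_gap D f k : compatible D f -> k < n ->
  ext_val f k + D k <= ext_val f k.+1.
Proof. by move=> /forallP cf lt_kn; apply: (cf (Ordinal lt_kn)). Qed.

Lemma compatible_gaps D f k l : compatible D f -> k <= l <= n ->
  ext_val f k + E D l <= ext_val f l + E D k.
Proof.
move=> cf /andP[]; elim: l => [|l IHl]; first by rewrite leqn0 => /eqP->.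
rewrite leq_eqVlt => /predU1P[->//|le_kl] lt_ln.
have := IHl le_kl (ltnW lt_ln); have := compatible_gap cf lt_ln.
have -> : E D l.+1 = E D l + D l by rewrite /E big_ord_recr.
lia.
Qed.

(** Removing the forced increase turns compatible functions into weakly increasing sequences in
    [{0, ..., m - d}]; for [d > m] the forced increase exceeds the available range. *)
Lemma card_compatible D (d := #|[set i : 'I_n | D i]|) :
  #|[set f | compatible D f]| = if d <= m then 'C(m - d + n, n) else 0.
Proof.
have Ed : E D n = d.
  by rewrite /d -sum1dep_card [RHS]big_mkcond; apply: eq_bigr => i; case: (D i).
have E_le k l : k <= l -> E D k <= E D l.
  move=> /subnKC <-; elim: (l - k) => [|j IHj]; first by rewrite addn0.
  by rewrite addnS /E big_ord_recr (leq_trans IHj) ?leq_addr.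
have E_rec k : E D k.+1 = E D k + D k by rewrite /E big_ord_recr.
have E0 : E D 0 = 0 by rewrite /E big_ord0.
case: leqP => [le_dm|lt_md]; last first.
  apply: eq_card0 => f; rewrite inE; apply/negP => cf.
  have := @compatible_gaps D f 0 n cf; rewrite leq0n leqnn => /(_ isT).
  by have := ext_val_max f n; rewrite E0 Ed /=; lia.
pose F (t : n.-tuple 'I_(m - d).+1) : {ffun 'I_n -> 'I_m.+1} :=
  [ffun k : 'I_n => inord (tnth t k + E D k.+1)].
have FE t (k : 'I_n) : F t k = tnth t k + E D k.+1 :> nat.
  rewrite ffunE inordK //; have := E_le k.+1 n (ltn_ord k).
  by have := ltn_ord (tnth t k); rewrite Ed; lia.
have F_inj : injective F.
  move=> t1 t2 eqF; apply: eq_from_tnth => k; apply: val_inj.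
  by apply: (@addIn (E D k.+1)); rewrite /= -!FE eqF.
rewrite addnC -card_sorted_tuples -(card_imset _ F_inj).
suff cfE (f : {ffun 'I_n -> 'I_m.+1}) : compatible D f =
    (f \in F @: [set t : n.-tuple 'I_(m - d).+1 | sorted leq (map val t)]).
  by apply: eq_card => f; rewrite inE cfE.
apply/idP/imsetP => [cf|[t]]; last first.
  rewrite inE => /sorted_tupleP st ->; apply/forallP => -[[|i] lt_in].
    by rewrite add0n (ext_valS _ (Ordinal lt_in)) FE E_rec /=; lia.
  have lt_in' := ltnW lt_in.
  rewrite (ext_valS _ (Ordinal lt_in)) (ext_valS _ (Ordinal lt_in')) !FE /=.
  have := st (Ordinal lt_in') (Ordinal lt_in) erefl.
  by rewrite (E_rec i.+1); lia.
(* The lower bound comes from the gap between 0 and [k + 1], the upper one from the gap between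
   [k + 1] and [n]. *)
have f_ge (k : 'I_n) : E D k.+1 <= f k <= m - d + E D k.+1.
  have := @compatible_gaps D f 0 k.+1 cf (ltn_ord k).
  have := @compatible_gaps D f k.+1 n cf; rewrite ltn_ord leqnn => /(_ isT).
  by have := ext_val_max f n; rewrite ext_valS E0 Ed /=; lia.
pose t := [tuple (inord (f k - E D k.+1) : 'I_(m - d).+1) | k < n].
have tE k : tnth t k = f k - E D k.+1 :> nat.
  by rewrite tnth_mktuple inordK //; have := f_ge k; lia.
exists t; last first.
  by apply/ffunP => k; apply: ord_inj; rewrite FE tE subnK //; case/andP: (f_ge k).
rewrite inE; apply/sorted_tupleP => k l eq_l; rewrite !tE.
have := @compatible_gap D f l cf (ltn_ord l).
by rewrite ext_valS (E_rec l) eq_l ext_valS; lia.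
Qed.

End CompatibleFunctions.

(** * Signed involutions and their descents *)

Section SignedInvolutions.
Variable n : nat.
Implicit Types (w : {perm pm n}) (k l : 'I_n).

Definition sperm_sign w k : bool := (w (false, k)).1.
Definition sperm_abs w k : 'I_n := (w (false, k)).2.

Lemma hyperoctE w b k : w \in hyperoct n ->
  w (b, k) = (b (+) sperm_sign w k, sperm_abs w k).
Proof.
rewrite inE => /forallP/(_ (false, k))/eqP wN; case: b => /=.
  by rewrite -[(true, k)]/(pm_opp (false, k)) wN.
exact: surjective_pairing.
Qed.

Lemma hyperoct_involP w :
  w \in hyperoct_invol n -> w \in hyperoct n /\ involutive w.
Proof.
rewrite inE => /andP[wB /eqP wV]; split=> // a.
by rewrite -{1}wV permK.
Qed.

Lemma sperm_absK w : w \in hyperoct_invol n -> involutive (sperm_abs w).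
Proof.
case/hyperoct_involP => wB wK k.
by have := wK (false, k); rewrite !hyperoctE // => -[].
Qed.

(** If [w(k) = e j] with a sign [e], then [w(w(k)) = k] gives [w(j) = e k]. *)
Lemma sperm_sign_abs w k : w \in hyperoct_invol n ->
  sperm_sign w (sperm_abs w k) = sperm_sign w k.
Proof.
case/hyperoct_involP => wB wK.
have := wK (false, k); rewrite !hyperoctE // => -[+ _].
by case: (sperm_sign w k); case: (sperm_sign w _).
Qed.

Lemma eq_hyperoct w w' : w \in hyperoct n -> w' \in hyperoct n ->
  sperm_sign w =1 sperm_sign w' -> sperm_abs w =1 sperm_abs w' -> w = w'.
Proof.
move=> wB wB' eq_s eq_a; apply/permP => -[b k].
by rewrite !hyperoctE // eq_s eq_a.
Qed.

Lemma hyperoct_invol_exists (s : 'I_n -> bool) (t : 'I_n -> 'I_n) :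
    involutive t -> (forall k, s (t k) = s k) ->
  exists2 w, w \in hyperoct_invol n &
    sperm_sign w =1 s /\ sperm_abs w =1 t.
Proof.
move=> tK st; pose F (a : pm n) : pm n := (a.1 (+) s a.2, t a.2).
have FK : involutive F by move=> [b k]; rewrite /F /= tK st addbK.
pose w := perm (inv_inj FK); exists w; last first.
  by split=> k; rewrite /sperm_sign /sperm_abs permE.
rewrite !inE; apply/andP; split.
  by apply/forallP => -[b k]; rewrite !permE /F /pm_opp /= addNb.
apply/eqP/permP => a; apply: (@perm_inj _ w).
by rewrite permKV !permE FK.
Qed.

(* The position of a signed value in the order -1 < -2 < ... < 0 < 1 < 2 < ...
   of {-n, ..., n}, in which 0 has position n. *)
Definition pm_rank (a : pm n) : nat := if a.1 then a.2 : nat else n + a.2.+1.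

Definition sperm_rank w (k : nat) : nat :=
  if k is k'.+1 then if insub k' is Some i then pm_rank (w (false, i)) else n
  else n.

Lemma lt_r_rank w (k l : nat) :
  lt_r (sperm_val w k) (sperm_val w l) = (sperm_rank w k < sperm_rank w l).
Proof.
have lt_pm (a b : pm n) : lt_r (pm_int a) (pm_int b) = (pm_rank a < pm_rank b).
  case: a b => [[] i] [[] j]; rewrite /pm_int /lt_r /pm_rank /= ?expr1 ?expr0;
  by have := (ltn_ord i, ltn_ord j) => -[]; do 2?case: ifP; lia.
have lt_pm0 (a : pm n) : lt_r (pm_int a) 0%R = (pm_rank a < n).
  case: a => [[] i]; rewrite /pm_int /lt_r /pm_rank /= ?expr1 ?expr0;
  by have := ltn_ord i; do 2?case: ifP; lia.
have lt_0pm (a : pm n) : lt_r 0%R (pm_int a) = (n < pm_rank a).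
  case: a => [[] i]; rewrite /pm_int /lt_r /pm_rank /= ?expr1 ?expr0;
  by have := ltn_ord i; do 2?case: ifP; lia.
have lt_00 : lt_r 0%R 0%R = (n < n) by rewrite ltnn.
by case: k l => [|k] [|l] //=; do ?case: insub => [?|].
Qed.

Lemma sperm_rankS w k :
  sperm_rank w k.+1 = if sperm_sign w k then sperm_abs w k : nat
                      else n + (sperm_abs w k).+1.
Proof. by rewrite /= valK. Qed.

(** [w] is injective and never 0. Hence a position that is not a descent is a strict ascent, which
    makes the lexicographic comparison below strict. *)
Lemma sperm_rank_neq w k : sperm_rank w k != sperm_rank w k.+1.
Proof.
rewrite sperm_rankS; case: k => [[|k] lt_kn].
  rewrite [sperm_rank _ _]/=; case: ifP => _; last by lia.
  by have := ltn_ord (sperm_abs w (Ordinal lt_kn)); lia.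
have lt_kn' := ltnW lt_kn.
rewrite -[X in sperm_rank w X]/((Ordinal lt_kn').+1) sperm_rankS.
apply/eqP => eq_r.
suff: w (false, Ordinal lt_kn') = w (false, Ordinal lt_kn).
  by move/perm_inj => -[]; lia.
move: eq_r; rewrite /sperm_sign /sperm_abs.
case: (w _) => [b i]; case: (w _) => [b' j] /=.
have := ltn_ord i; have := ltn_ord j.
by case: b; case: b' => *; congr pair; try (apply: ord_inj); lia.
Qed.

Definition descent w : pred nat :=
  fun i => lt_r (sperm_val w i.+1) (sperm_val w i).

Variable m : nat.
Implicit Types f : {ffun 'I_n -> 'I_m.+1}.

(* Strict increase of the word of pairs (f k, w k), k = 0, ..., n, in the
   lexicographic order. *)
Definition lex_compatible w f :=
  (forall k l, k < l -> f k < f l \/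
     f k = f l /\ sperm_rank w k.+1 < sperm_rank w l.+1) /\
  (forall k, f k = ord0 -> ~~ sperm_sign w k).

(** Compatibility compares consecutive pairs [(f k, w k)]; transitivity extends this to all pairs,
    and the comparison with the initial pair [(0, 0)] says that [f k = 0] forces a positive
    [w k]. *)
Lemma compatibleP w f :
  reflect (lex_compatible w f) (compatible (descent w) f).
Proof.
pose g (k : nat) := (ext_val f k, sperm_rank w k).
pose lt2 (p q : nat * nat) := (p.1 < q.1) || (p.1 == q.1) && (p.2 < q.2).
have lt2_trans : transitive lt2 by move=> [? ?] [? ?] [? ?]; rewrite /lt2 /=; lia.
(* At a descent the first entry must rise; elsewhere the second rises strictly, so a tie in the
   first is allowed. *)
have stepE (k : 'I_n) :
    (ext_val f k + descent w k <= ext_val f k.+1) = lt2 (g k) (g k.+1).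
  have := sperm_rank_neq w k; rewrite /descent lt_r_rank /lt2 /g.
  case: (ltngtP (sperm_rank w k.+1)); rewrite /=; lia.
apply: (iffP forallP) => [cf|[lt_f f0] k].
  have lt_g i j : i < j -> j <= n -> lt2 (g i) (g j).
    elim: j => // j IHj; rewrite ltnS leq_eqVlt => lt_ij lt_jn.
    have gj : lt2 (g j) (g j.+1) by rewrite -(stepE (Ordinal lt_jn)).
    case/predU1P: lt_ij => [->//|/IHj lt_g]; apply: lt2_trans gj.
    exact: lt_g (ltnW _).
  split=> [k l lt_kl|k fk0].
    have := lt_g k.+1 l.+1 lt_kl (ltn_ord l).
    rewrite /lt2 /g /= -/(sperm_rank w k.+1) -/(sperm_rank w l.+1) !valK.
    move=> /orP[->|/andP[/eqP/ord_inj-> ->]].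
      by left.
    by right.
  have := lt_g 0 k.+1 isT (ltn_ord k).
  rewrite /lt2 [(g k.+1).1]ext_valS fk0 [(g k.+1).2]sperm_rankS /=.
  by case: ifP => //; have := ltn_ord (sperm_abs w k); lia.
rewrite stepE /lt2 [(g k.+1).1]ext_valS -[(g k.+1).2]/(sperm_rank w k.+1).
case: k => [[|k] lt_kn].
  rewrite -[(g (Ordinal _)).1]/0 -[(g (Ordinal _)).2]/n.
  have [fk0|//] := posnP (f (Ordinal lt_kn)).
  rewrite sperm_rankS (negbTE (f0 _ _)); last exact: ord_inj.
  by rewrite fk0 addnS ltnS leq_addr.
have lt_kn' := ltnW lt_kn.
rewrite -[g (Ordinal lt_kn)]/(g (Ordinal lt_kn').+1) [(g _).1]ext_valS.
case: (lt_f (Ordinal lt_kn') (Ordinal lt_kn) (ltnSn k)) => [->//|[-> lt_rk]].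
by rewrite eqxx ltnn.
Qed.

End SignedInvolutions.

(** * Multisets of points *)

Section Cells.
Variable m : nat.

(* The cell (c, s, d) stands for the point (c, (-1)^s d) of
   {0, ..., m} x {-m, ..., m}. *)
Definition cell : finType := ('I_m.+1 * bool * 'I_m.+1)%type.
Implicit Types p q : cell.

Definition cell_swap p : cell := (p.2, p.1.2, p.1.1).

(** A mixed-radix encoding of the lexicographic order in which negative second coordinates precede
    the others and each sign class is ordered by absolute value, as in [lt_r]. *)
Definition cell_code p : nat := (p.1.1 * 2 + ~~ p.1.2) * m.+1 + p.2.

(** Discards the duplicates [(c, -0)] and their mirror images [(0, -c)]. *)
Definition cell_ok p : bool := p.1.2 ==> (0 < p.1.1) && (0 < p.2).

(** One cell per orbit of [cell_swap] on the cells kept; [cell_wt] is the size of the orbit. *)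
Definition cell_rep p : bool := cell_ok p && (p.1.1 <= p.2).

Definition cell_wt p : nat := if p.1.1 == p.2 then 1 else 2.

Lemma cell_swapK : involutive cell_swap.
Proof. by move=> [[c s] d]. Qed.

Lemma cell_ok_swap p : cell_ok (cell_swap p) = cell_ok p.
Proof. by rewrite /cell_ok /= andbC. Qed.

Lemma leq_cell_code p q : (cell_code p <= cell_code q) =
  (p.1.1 < q.1.1) || (p.1.1 == q.1.1) &&
    ((p.1.2 && ~~ q.1.2) || (p.1.2 == q.1.2) && (p.2 <= q.2)).
Proof.
case: p q => [[c s] d] [[c' s'] d']; rewrite /cell_code /= -val_eqE /=.
have lex (a b : nat) : (a * m.+1 + d <= b * m.+1 + d') =
    (a < b) || (a == b) && (d <= d').
  have := ltn_ord d; have := ltn_ord d'.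
  case: (ltngtP a b) => [lt|lt|->] /=; last by rewrite leq_add2l.
    by have : a.+1 * m.+1 <= b * m.+1 by [rewrite leq_mul2r lt orbT]; lia.
  by have : b.+1 * m.+1 <= a * m.+1 by [rewrite leq_mul2r lt orbT]; lia.
by rewrite lex; case: s s' => -[] /=; lia.
Qed.

Lemma cell_code_inj : injective cell_code.
Proof.
move=> p q eq_c.
have : cell_code p <= cell_code q <= cell_code p by rewrite eq_c leqnn.
rewrite !leq_cell_code; case: p q {eq_c} => [[c s] d] [[c' s'] d'] /=.
rewrite -!val_eqE /= => h.
have -> : c = c' by apply: ord_inj; lia.
have -> : d = d' by apply: ord_inj; case: s s' h => -[] /=; lia.
by congr (_, _, _); case: s s' h => -[] //=; lia.
Qed.

(** Summation by orbits: the part with [c > d] reflects onto the part with [c < d]. *)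
Lemma sum_cells (M : cell -> nat) :
    (forall p, M (cell_swap p) = M p) -> (forall p, ~~ cell_ok p -> M p = 0) ->
  \sum_p M p = \sum_(p | cell_rep p) cell_wt p * M p.
Proof.
move=> Msw M0.
have -> : \sum_p M p = \sum_(p | cell_ok p) M p.
  by rewrite [RHS]big_mkcond; apply: eq_bigr => p _; case: ifP => // /negbT/M0.
rewrite (bigID (fun p => p.1.1 <= p.2)) /= -/cell_rep.
have -> : \sum_(p | cell_ok p && ~~ (p.1.1 <= p.2)) M p =
          \sum_(p | cell_ok p && (p.1.1 < p.2)) M p.
  rewrite (reindex_inj (inv_inj cell_swapK)).
  apply: eq_big => p; last by rewrite Msw.
  by rewrite cell_ok_swap /= -ltnNge.
rewrite [X in _ + X](_ : _ = \sum_(p | cell_rep p && (p.1.1 != p.2)) M p).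
  rewrite [X in _ + X]big_mkcondr -big_split; apply: eq_bigr => p _.
  by rewrite /cell_wt; case: eqP => /=; lia.
apply: eq_bigl => p; rewrite /cell_rep -andbA ltn_neqAle; congr (_ && _).
by rewrite andbC.
Qed.

End Cells.

(** * Orbit counts *)

Section CellCounts.
Variable m : nat.

Lemma sum_cellsE (F : 'I_m.+1 -> bool -> 'I_m.+1 -> nat) :
  \sum_(p : cell m) F p.1.1 p.1.2 p.2 =
  \sum_c \sum_d F c true d + \sum_c \sum_d F c false d.
Proof.
rewrite -(pair_bigA _ (fun p d => F p.1 p.2 d)) /=.
rewrite -(pair_bigA _ (fun c s => \sum_d F c s d)) /= -big_split.
by apply: eq_bigr => c _; rewrite big_bool.
Qed.

(** These are the points [(c, c)] with [0 <= c <= m] and [(c, -c)] with [1 <= c <= m]. *)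
Lemma card_diagonal_reps :
  #|[pred p : cell m | cell_rep p && (p.1.1 == p.2)]| = 2 * m + 1.
Proof.
rewrite -sum1_card big_mkcond.
pose F (c : 'I_m.+1) s (d : 'I_m.+1) : nat :=
  (s ==> (0 < c) && (0 < d)) && (c <= d) && (c == d).
rewrite (eq_bigr (fun p : cell m => F p.1.1 p.1.2 p.2)); last first.
  by move=> p _; rewrite /F inE /cell_rep /cell_ok; case: ifP.
have sumF s c : \sum_d F c s d = (s ==> (0 < c)).
  rewrite (bigD1 c) //= big1 => [|d /negbTE].
    by rewrite /F eqxx leqnn andbb !andbT addn0.
  by rewrite /F eq_sym => ->; rewrite andbF.
rewrite sum_cellsE; under eq_bigr do rewrite sumF /=.
under [X in _ + X]eq_bigr do rewrite sumF /=.
by rewrite big_ord_recl /= !sum_nat_const !card_ord; lia.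
Qed.

(** [sum_cells] for the indicator of [cell_ok] reads [m^2 + (m + 1)^2 = (2m + 1) + 2 N], where [N]
    is the number sought. *)
Lemma card_offdiagonal_reps :
  #|[pred p : cell m | cell_rep p && (p.1.1 != p.2)]| = m ^ 2.
Proof.
have := @sum_cells m (fun p => cell_ok p).
rewrite (@sum_cellsE (fun c s d => s ==> (0 < c) && (0 < d))) big_ord_recl /=.
rewrite big1 // add0n.
under eq_bigr do rewrite big_ord_recl /=.
rewrite !sum_nat_const !card_ord (bigID (fun p => p.1.1 == p.2)) /=.
rewrite (eq_bigr (fun=> 1)) => [|p]; last first.
  by case/andP=> /andP[p_ok _] pd; rewrite /cell_wt pd p_ok.
rewrite [X in _ = _ + X](eq_bigr (fun=> 2)) => [|p]; last first.
  by case/andP=> /andP[p_ok _] /negbTE pd; rewrite /cell_wt pd p_ok.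
rewrite !sum_nat_const card_diagonal_reps => h.
have := h (fun p => congr1 nat_of_bool (cell_ok_swap p))
  (fun p p_nok => congr1 nat_of_bool (negbTE p_nok)).
set N := #|[pred _ | _]|; rewrite -[X in _ + X * 2]/N -mulnn.
by lia.
Qed.

End CellCounts.

(** * Words of points and their multiplicities *)

Section CellWords.
Variables (n m : nat).
Implicit Types (w : {perm pm n}) (f : {ffun 'I_n -> 'I_m.+1}).

Definition cell_word w f (k : 'I_n) : cell m :=
  (f k, sperm_sign w k, f (sperm_abs w k)).

(** Ties of [f] are broken by the sign and then by [|w|], and [f] is weakly increasing, so the word
    is sorted. At equal points [f] and the sign agree, so the ranks compare [|w|]. *)
Lemma cell_word_compatible w f :
    w \in hyperoct_invol n -> compatible (descent w) f ->
  [/\ word_sorted (@cell_code m) (cell_word w f),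
      standardizes (cell_word w f) (@cell_swap m) (sperm_abs w)
    & forall k, cell_ok (cell_word w f k)].
Proof.
move=> wI /compatibleP[lt_f f0].
have f_incr (k l : 'I_n) : k <= l -> f k <= f l.
  rewrite leq_eqVlt => /predU1P[/ord_inj->//|/lt_f[/ltnW//|[-> _]//]].
have f0' k : f k = 0 :> nat -> sperm_sign w k = false.
  by move=> fk0; apply/negbTE/f0/ord_inj.
split=> [k l|| k].
- rewrite leq_eqVlt leq_cell_code /= => /predU1P[/ord_inj->|/lt_f].
    by rewrite !eqxx leqnn !orbT.
  case=> [->//|[->]]; rewrite !sperm_rankS eqxx /= => lt_r.
  apply/orP; right; move: lt_r.
  case: (sperm_sign w k); case: (sperm_sign w l) => //=.
  - by move/ltnW/f_incr.
  - by have := ltn_ord (sperm_abs w l); lia.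
  by rewrite ltn_add2l ltnS => /ltnW/f_incr.
- split=> [|k|k l [fE sE dE] /lt_f]; first exact: sperm_absK.
    by rewrite /cell_word sperm_absK // sperm_sign_abs.
  by rewrite fE ltnn !sperm_rankS sE => -[//|[_]]; case: ifP => _; lia.
(* The sign is negative at both [k] and [|w k|], and a zero of [f] would force it to be positive. *)
apply/implyP => /= sk; apply/andP; split; rewrite lt0n; apply/negP => /eqP fk0.
  by rewrite f0' in sk.
by rewrite -(sperm_sign_abs k wI) f0' in sk.
Qed.

(** The first coordinates give [f], the sign bits give the signs of [w], and [t] gives [|w|]. *)
Lemma compatible_exists (u : 'I_n -> cell m) t :
    word_sorted (@cell_code m) u -> standardizes u (@cell_swap m) t ->
    (forall k, cell_ok (u k)) ->
  exists w, exists f, [/\ w \in hyperoct_invol n, compatible (descent w) f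
    & cell_word w f =1 u].
Proof.
move=> u_sorted [tK ut t_incr] u_ok.
have [|w wI [ws wt]] := @hyperoct_invol_exists n (fun k => (u k).1.2) t tK.
  by move=> k; rewrite ut.
pose f := [ffun k => (u k).1.1].
have fE k : f k = (u k).1.1 by rewrite ffunE.
have wE : cell_word w f =1 u.
  by move=> k; rewrite /cell_word ws wt !fE ut /=; case: (u k) => [[]].
exists w, f; split=> //; apply/compatibleP; split=> [k l lt_kl|k fk0]; last first.
  rewrite ws; apply/negP => sk; have := u_ok k.
  by rewrite /cell_ok sk -fE fk0.
have := u_sorted k l (ltnW lt_kl); rewrite leq_cell_code -!fE.
case/orP => [->|/andP[/eqP fkl h]]; first by left.
right; split=> //; rewrite !sperm_rankS !ws !wt.
case/orP: h => [/andP[-> /negbTE->]|/andP[/eqP skl]].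
  by have := ltn_ord (t k); lia.
(* If the second coordinates agree, so do the letters, and [t] increases on a level. Otherwise
   sortedness decides, since [u (t k)] has first coordinate [(u k).2]. *)
have lt_of : (u k).2 <= (u l).2 -> t k < t l.
  rewrite leq_eqVlt => /predU1P[/ord_inj dkl|lt_d].
    apply: t_incr => //; move: fkl skl dkl; rewrite !fE.
    by case: (u k) (u l) => [[? ?] ?] [[? ?] ?] /= -> -> ->.
  rewrite ltnNge; apply/negP => /u_sorted; rewrite leq_cell_code !ut /=.
  by rewrite ltnNge (ltnW lt_d) => /andP[/eqP dE]; rewrite dE ltnn in lt_d.
by move=> /lt_of; rewrite skl; case: ifP => _; lia.
Qed.

Lemma sum_level (C : finType) (u : 'I_n -> C) : \sum_p #|level u p| = n.
Proof.
rewrite -[RHS]card_ord -sum1_card (partition_big u xpredT) //=.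
by apply: eq_bigr => p _; rewrite -sum1_card; apply: eq_bigl => k; rewrite inE.
Qed.

(** The bijection records multiplicities on orbit representatives only; symmetry under reflection
    supplies the others. *)
Lemma card_compatible_invol :
  #|[set wf : {perm pm n} * {ffun 'I_n -> 'I_m.+1} |
      (wf.1 \in hyperoct_invol n) && compatible (descent wf.1) wf.2]| =
  #|[set a : {ffun cell m -> 'I_n.+1} |
      (a \in pffun_on ord0 (@cell_rep m) predT)
      && (\sum_(p | cell_rep p) cell_wt p * a p == n)]|.
Proof.
pose mult (wf : {perm pm n} * {ffun 'I_n -> 'I_m.+1}) :
    {ffun cell m -> 'I_n.+1} :=
  [ffun p => if cell_rep p then inord #|level (cell_word wf.1 wf.2) p| else ord0].
have multE wf p : mult wf p =
    (if cell_rep p then #|level (cell_word wf.1 wf.2) p| else 0) :> nat.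
  rewrite ffunE; case: ifP => // _; rewrite inordK // ltnS.
  by rewrite -[leqRHS]card_ord max_card.
have level0 (u : 'I_n -> cell m) p :
    (forall k, cell_ok (u k)) -> ~~ cell_ok p -> #|level u p| = 0.
  move=> u_ok; apply: contraNeq; rewrite -lt0n => /card_gt0P[k].
  by rewrite inE => /eqP <-.
rewrite -(card_in_imset (f := mult)); last first.
  move=> [w f] [w' f']; rewrite inE => /andP[/= wI cf].
  rewrite inE => /andP[/= wI' cf'] eqm.
  have [us ust u_ok] := cell_word_compatible wI cf.
  have [us' ust' u_ok'] := cell_word_compatible wI' cf'.
  have eq_u : cell_word w f =1 cell_word w' f'.
    apply: (word_sorted_inj (@cell_code_inj m) us us').
    have eq_rep p : cell_rep p ->
        #|level (cell_word w f) p| = #|level (cell_word w' f') p|.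
      by move=> Dp; move/ffunP/(_ p)/(congr1 val): eqm; rewrite /= !multE Dp.
    (* Cells outside [cell_ok] do not occur, and cells with [c > d] are counted through their
       reflection. *)
    move=> p; have [p_ok|p_nok] := boolP (cell_ok p); last by rewrite !level0.
    have [le_cd|lt_dc] := leqP p.1.1 p.2; first by rewrite eq_rep // /cell_rep p_ok.
    rewrite -(card_level_standardizes p ust (@cell_swapK m)).
    rewrite -(card_level_standardizes p ust' (@cell_swapK m)).
    by rewrite eq_rep // /cell_rep cell_ok_swap p_ok ltnW.
  have eq_f : f = f' by apply/ffunP => k; case: (eq_u k).
  congr (_, _) => //; apply: eq_hyperoct => [||k|].
  - by case/hyperoct_involP: wI.
  - by case/hyperoct_involP: wI'.
  - by case: (eq_u k).
  apply: standardizes_uniq ust _; case: ust' => tK ut t_incr.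
  by split=> // [k|k l]; rewrite !eq_u; [apply: ut|apply: t_incr].
apply: eq_card => a; rewrite inE; apply/imsetP/andP => [[[w f]]|[]].
  rewrite inE /= => /andP[wI cf] ->.
  have [us ust u_ok] := cell_word_compatible wI cf.
  split.
    apply/pffun_onP; split=> //; apply/subsetP => p; rewrite inE.
    by apply: contraNT; rewrite ffunE -[p \in _]/(cell_rep p) => /negbTE->.
  rewrite -[X in _ == X](sum_level (cell_word w f)) sum_cells.
  - by apply/eqP/eq_bigr => p Dp; rewrite multE Dp.
  - by move=> p; rewrite (card_level_standardizes p ust (@cell_swapK m)).
  by move=> p; apply: level0.
move=> /pffun_onP[a_supp _] /eqP sum_a.
(* [M] extends [a] to all cells, symmetrically under reflection. *)
pose M (p : cell m) : nat := if p.1.1 <= p.2 then a p else a (cell_swap p).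
have a0 p : ~~ cell_rep p -> a p = ord0.
  by move=> Dp; apply/eqP; apply: contraNT Dp => /(subsetP a_supp).
have Msw p : M (cell_swap p) = M p.
  rewrite /M /= cell_swapK; case: ltngtP => //.
  by case: p => [[c s] d] /= /ord_inj->.
have M0 p : ~~ cell_ok p -> M p = 0.
  move=> p_nok; rewrite /M; case: ifP => _; rewrite a0 //.
    by rewrite /cell_rep (negbTE p_nok).
  by rewrite /cell_rep cell_ok_swap (negbTE p_nok).
have MD p : cell_rep p -> M p = a p by rewrite /M => /andP[_ ->].
have sumM : \sum_p M p = n.
  by rewrite sum_cells // -[RHS]sum_a; apply: eq_bigr => p /MD->.
have [u us uM] := word_sorted_exists (@cell_code m) sumM.
have u_ok k : cell_ok (u k).
  apply: contraT => /M0; rewrite -uM => /eqP; rewrite cards_eq0 => /eqP/setP/(_ k).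
  by rewrite !inE eqxx.
have [|t ut] := standardizes_exists (u := u) (@cell_swapK m).
  by move=> p; rewrite !uM Msw.
have [w [f [wI cf wE]]] := compatible_exists us ut u_ok.
exists (w, f); first by rewrite inE /= wI.
apply/ffunP => p; apply: ord_inj; rewrite multE /=.
case: ifP => [Dp|/negbT/a0-> //]; rewrite -MD // -uM.
by apply: eq_card => k; rewrite !inE wE.
Qed.

End CellWords.

End Combinatorics.

(** * The two generating functions *)

Definition num_compatible (m n : nat) : nat :=
  #|[set wf : {perm pm n} * {ffun 'I_n -> 'I_m.+1} |
      (wf.1 \in hyperoct_invol n) && compatible (descent wf.1) wf.2]|.

(** Each [w] contributes [x^des(w) / (1 - x)^(n+1)], whose coefficient of [x^m] is the number of
    compatible [f]. *)
Lemma coef_involB_des (R : comUnitRingType) m n (x := fps_var R) :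
  (involB_des n x / (1 - x) ^+ n.+1)^[m] = (num_compatible m n)%:R.
Proof.
rewrite (mulr1_eq (mul_fps_binom R n)) mulr_suml coef_fps_sum /num_compatible.
rewrite -sum1_card (eq_bigl _ _ (fun wf => in_set _ wf)).
rewrite -(pair_big_dep (mem (hyperoct_invol n))
  (fun w (f : {ffun 'I_n -> 'I_m.+1}) => compatible (descent w) f) (fun _ _ => 1%N)).
rewrite natr_sum; apply: eq_bigr => w _.
by rewrite sum1dep_card card_compatible /x coef_fps_varXM /= -/(desB w); case: leqP.
Qed.

(** Each orbit contributes one factor, [1 - t] for a fixed point and [1 - t^2] for a pair. The
    inverse is a product of geometric series, which counts multiplicity functions by weight. *)
Lemma coef_symmetric_points (R : comUnitRingType) m n (t := fps_var R) :
  (((1 - t) ^+ (2 * m + 1) * (1 - t ^+ 2) ^+ (m ^ 2))^-1)^[n] =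
  (num_compatible m n)%:R.
Proof.
rewrite /num_compatible card_compatible_invol -coef_prod_fps_geom; last first.
  by move=> p _; rewrite /cell_wt; case: ifP.
congr (coefs _ n); apply: mulr1_eq.
have -> : (1 - t) ^+ (2 * m + 1) * (1 - t ^+ 2) ^+ (m ^ 2) =
    \prod_(p | cell_rep (m := m) p) (1 - t ^+ cell_wt p).
  rewrite (bigID (fun p => p.1.1 == p.2)) /=; congr (_ * _).
    rewrite (eq_bigr (fun=> 1 - t)) => [|p /andP[_ pd]]; last by rewrite /cell_wt pd.
    by rewrite prodr_const card_diagonal_reps.
  rewrite (eq_bigr (fun=> 1 - t ^+ 2)) => [|p /andP[_ /negbTE pd]].
    by rewrite prodr_const card_offdiagonal_reps.
  by rewrite /cell_wt pd.
rewrite -big_split big1 // => p _ /=; apply: mul_fps_geom.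
by rewrite /cell_wt; case: ifP.
Qed.

Theorem theorem1p1 :
  let x := fps_x in
  let t := fps_t in
  exists S : fps2,
    fps2_has_sum (fun n : nat => involB_des n x / (1 - x) ^+ n.+1 * t ^+ n) S /\
    fps2_has_sum
      (fun m : nat =>
         x ^+ m / ((1 - t) ^+ (2 * m + 1) * (1 - t ^+ 2) ^+ (m ^ 2))) S.
Proof.
move=> x t; exists (Fps (fun j => Fps (fun i => (num_compatible i j)%:R))).
(* Only the term [n = j] of the first sum and the term [m = i] of the second contribute to
   [x^i t^j]; hence the bounds. *)
split=> i j; [exists j.+1|exists i.+1] => M ltM; rewrite !coef_fps_sum.
  (* The quotient is constant in [t]: the inverses in [Z[[x]]] and in [Z[[x]][[t]]] are both given
     by [fps_binom]. *)
  have termE n : involB_des n x / (1 - x) ^+ n.+1 =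
      fps_const (involB_des n (fps_var int) / (1 - fps_var int) ^+ n.+1).
    rewrite (mulr1_eq (mul_fps_binom int n)).
    have /mulr1_eq -> : (1 - x) ^+ n.+1 * fps_const (fps_binom int n) = 1.
      rewrite /x /fps_x -[1 - _](rmorphB _ 1) -rmorphXn -rmorphM.
      by rewrite mul_fps_binom rmorph1.
    rewrite rmorphM rmorph_sum; congr (_ * _).
    by apply: eq_bigr => w _; rewrite rmorphXn.
  under eq_bigr => n _ do rewrite termE coef_fps_constM coef_fps_varX mulr_natr.
  rewrite (bigD1 (Ordinal ltM)) // eqxx mulr1n coef_involB_des.
  rewrite big1 => [|n]; first exact: addr0.
  rewrite -val_eqE eq_sym => /negbTE ne_nj.
  by rewrite [j == n :> nat]ne_nj mulr0n.
(* The coefficient of [t^j] in the [m]-th term is an integer times [x^m]. *)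
under eq_bigr => m _ do
  rewrite /x /fps_x -rmorphXn coef_fps_constM coef_symmetric_points
    coef_fps_varXM coef_fps_natr.
rewrite (bigD1 (Ordinal ltM)) // leqnn subnn big1 => [|m]; first exact: addr0.
rewrite -val_eqE /= => ne_mi.
by rewrite subn_eq0; case: ltngtP ne_mi.
Qed.
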